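(* Let $\kappa$ be a regular infinite cardinal and $\mu$ a singular cardinal with $\mathrm{cf}(\mu)=\kappa$. The spaces $({}^{\mu}2,\mu)$ and $({}^{\mu}\mu,\mu)$ are homeomorphic if and only if $\mu$ is not a strong limit cardinal (i.e., iff there is $\lambda<\mu$ with $2^\lambda\ge\mu$).
   Context: For ordinals $\delta,\rho$, ${}^{\delta}\rho$ is the set of functions $\delta\to\rho$; for a partial function $s\colon\delta\rightharpoonup\rho$, $[s]=\{f\in{}^{\delta}\rho: s\subseteq f\}$. The ${<}\mu$-box topology on ${}^{\delta}\rho$ has base $\{[s]: |\mathrm{dom}(s)|<\mu\}$; $(X,\mu)$ denotes $X$ with this topology. *)

(* Defs.v *)
(* plain set-theoretic definitions on Rocq types.
   Cardinals are represented by initial ordinals: a type with a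
   well-ordering whose proper initial segments all have strictly
   smaller cardinality. *)

Definition card_le (A B : Type) : Prop :=
  exists f : A -> B, forall x y, f x = f y -> x = y.

Definition card_lt (A B : Type) : Prop := card_le A B /\ ~ card_le B A.

Definition card_eq (A B : Type) : Prop :=
  exists (f : A -> B) (g : B -> A),
    (forall x, g (f x) = x) /\ (forall y, f (g y) = y).

Definition infinite (A : Type) : Prop := card_le nat A.

Record is_cardinal (M : Type) (lt : M -> M -> Prop) : Prop := {
  card_wf : well_founded lt;
  card_irrefl : forall x, ~ lt x x;
  card_trans : forall x y z, lt x y -> lt y z -> lt x z;
  card_total : forall x y, lt x y \/ x = y \/ lt y x;
  card_initial : forall x, card_lt {y : M | lt y x} M
}.

Definition cofinal {M : Type} (lt : M -> M -> Prop) (X : M -> Prop) : Prop :=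
  forall x, exists y, X y /\ ~ lt y x.

Definition cf_is {M : Type} (lt : M -> M -> Prop) (K : Type) : Prop :=
  (exists X, cofinal lt X /\ card_eq {x : M | X x} K) /\
  (forall X, cofinal lt X -> card_le K {x : M | X x}).

Definition regular_infinite (K : Type) (ltK : K -> K -> Prop) : Prop :=
  is_cardinal K ltK /\ infinite K /\ cf_is ltK K.

(* strong limit: for every lambda < mu (represented by a subset of M of
   cardinality < |M|), 2^lambda < mu *)
Definition strong_limit (M : Type) : Prop :=
  forall A : M -> Prop, card_lt {x : M | A x} M ->
    card_lt ({x : M | A x} -> bool) M.

Definition ext {D R : Type} (s : D -> option R) (f : D -> R) : Prop :=
  forall d r, s d = Some r -> f d = r.

Definition small_dom {D R : Type} (M : Type) (s : D -> option R) : Prop :=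
  card_lt {d : D | s d <> None} M.

Definition box_open (M D R : Type) (U : (D -> R) -> Prop) : Prop :=
  forall f, U f -> exists s : D -> option R,
    small_dom M s /\ ext s f /\ (forall g, ext s g -> U g).

Definition box_continuous (M D1 R1 D2 R2 : Type) (h : (D1 -> R1) -> (D2 -> R2)) : Prop :=
  forall U, box_open M D2 R2 U -> box_open M D1 R1 (fun f => U (h f)).

Definition box_homeomorphic (M D R D' R' : Type) : Prop :=
  exists (h : (D -> R) -> (D' -> R')) (k : (D' -> R') -> (D -> R)),
    (forall f, k (h f) = f) /\ (forall g, h (k g) = g) /\
    box_continuous M D R D' R' h /\ box_continuous M D' R' D R k.

(* Main.v *)
(** If 2^|L| >= |M| for an infinite L of size < |M|, then |L -> bool| = |L -> M|
    and |M * L| = |M|; grouping the coordinates into blocks indexed by L and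
    recoding each block by a bijection between [L -> bool] and [L -> M] is the
    homeomorphism, since fewer than |M| blocks still cover fewer than |M|
    coordinates.

    If |M| is a strong limit, the spaces differ in cellularity. Fixing K
    coordinates gives |M|^|K| pairwise disjoint nonempty open subsets of
    [M -> M]. In [M -> bool] such a family yields pairwise incompatible small
    partial functions; those with domain of size at most a given cardinal
    below |M| number fewer than |M|, by an Erdos-Rado type colouring argument,
    and Koenig's diagonalisation along a cofinal map K -> M gives a
    contradiction. *)
From Stdlib Require Import Classical ClassicalEpsilon FunctionalExtensionality.
From Stdlib Require Import Wellfounded Lexicographic_Product Relation_Operators.
From Stdlib Require Import Lia List FinFun.
Require Import Defs.

(** * Proof irrelevance, choice and decidability *)

Lemma sig_inj {A : Type} {P : A -> Prop} (u v : {x | P x}) :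
  proj1_sig u = proj1_sig v -> u = v.
Proof.
  destruct u as [x p], v as [y q]; simpl; intros <-.
  now rewrite (proof_irrelevance _ p q).
Qed.

Lemma choice_fun {A : Type} {B : A -> Type} (R : forall a, B a -> Prop) :
  (forall a, exists b, R a b) -> exists f : forall a, B a, forall a, R a (f a).
Proof.
  intros H.
  exists (fun a => proj1_sig (constructive_indefinite_description _ (H a))).
  intros a. exact (proj2_sig (constructive_indefinite_description _ (H a))).
Qed.

Definition decide (P : Prop) : bool :=
  if excluded_middle_informative P then true else false.

Lemma decideP (P : Prop) : decide P = true <-> P.
Proof.
  unfold decide. destruct (excluded_middle_informative P); split; easy.
Qed.

(** * Cardinal comparison *)

(** Choice extracts the injection, which spares most later comparisons an explicit map between
    subset types. *)
Lemma card_le_of_rel {A B : Type} (R : A -> B -> Prop) :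
  (forall a, exists b, R a b) ->
  (forall a a' b, R a b -> R a' b -> a = a') -> card_le A B.
Proof.
  intros tot inj. destruct (choice_fun R tot) as [f Hf].
  exists f. intros x y E. apply (inj x y (f x)); [apply Hf|].
  rewrite E. apply Hf.
Qed.

Lemma card_le_refl (A : Type) : card_le A A.
Proof. now exists (fun x => x). Qed.

Lemma card_le_trans {A B C : Type} : card_le A B -> card_le B C -> card_le A C.
Proof. intros [f Hf] [g Hg]. exists (fun x => g (f x)). auto. Qed.

Lemma card_le_sig {A : Type} (P : A -> Prop) : card_le {x | P x} A.
Proof. exists (@proj1_sig _ _). intros x y; apply sig_inj. Qed.

Lemma card_le_prod {A A' B B' : Type} :
  card_le A A' -> card_le B B' -> card_le (A * B) (A' * B').
Proof.
  intros [f Hf] [g Hg]. exists (fun p => (f (fst p), g (snd p))).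
  intros [a b] [a' b'] E; simpl in E. injection E as E1 E2.
  f_equal; auto.
Qed.

Lemma card_le_codomain {L A B : Type} : card_le A B -> card_le (L -> A) (L -> B).
Proof.
  intros [f Hf]. exists (fun u l => f (u l)). intros u v E.
  apply functional_extensionality; intros l. apply Hf.
  exact (f_equal (fun w => w l) E).
Qed.

Lemma card_le_powerset {A B : Type} :
  card_le A B -> card_le (A -> bool) (B -> bool).
Proof.
  intros [f Hf].
  exists (fun u b => decide (exists a, f a = b /\ u a = true)).
  assert (H : forall u a, decide (exists a', f a' = f a /\ u a' = true) = u a).
  { intros u a. destruct (u a) eqn:E.
    - apply decideP. now exists a.
    - destruct (decide _) eqn:D; [|reflexivity].
      destruct (proj1 (decideP _) D) as (a' & E1 & E2).
      apply Hf in E1; congruence. }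
  intros u v E. apply functional_extensionality; intros a.
  rewrite <- (H u a), <- (H v a). exact (f_equal (fun w => w (f a)) E).
Qed.

Lemma card_le_curry (A B C : Type) : card_le (A -> B -> C) (A * B -> C).
Proof.
  exists (fun u p => u (fst p) (snd p)). intros u v E.
  apply functional_extensionality; intros a.
  apply functional_extensionality; intros b.
  exact (f_equal (fun w => w (a, b)) E).
Qed.

(** Traced backwards through [g] and [f], such a point ends in [A] outside the range of [g]. The
    Cantor-Bernstein bijection follows [f] on these points and inverts [g] on the rest. *)
Inductive not_from_right {A B : Type} (f : A -> B) (g : B -> A) : A -> Prop :=
| nfr_base a : (forall b, g b <> a) -> not_from_right f g a
| nfr_step a : not_from_right f g a -> not_from_right f g (g (f a)).

Lemma cantor_bernstein {A B : Type} : card_le A B -> card_le B A -> card_eq A B.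
Proof.
  intros [f Hf] [g Hg].
  set (C := not_from_right f g).
  set (R := fun a b => (C a /\ f a = b) \/ (~ C a /\ g b = a)).
  destruct (choice_fun R) as [h Hh].
  { intros a. destruct (classic (C a)) as [c|n].
    - exists (f a). now left.
    - destruct (classic (exists b, g b = a)) as [[b E]|N].
      + exists b. now right.
      + destruct n. constructor. intros b E. apply N. now exists b. }
  destruct (choice_fun (fun b a => R a b)) as [k Hk].
  { intros b. destruct (classic (C (g b))) as [c|n].
    - inversion c as [a N|a c' E]; [now destruct (N b)|].
      exists a. left. split; [exact c'|]. now apply Hg.
    - exists (g b). now right. }
  assert (fun_R : forall a b b', R a b -> R a b' -> b = b').
  { intros a b b' [[c E]|[c E]] [[c' E']|[c' E']]; try tauto; try congruence.
    apply Hg. congruence. }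
  assert (inj_R : forall a a' b, R a b -> R a' b -> a = a').
  { intros a a' b [[c E]|[c E]] [[c' E']|[c' E']]; subst; auto.
    - destruct c'. now constructor.
    - destruct c. now constructor. }
  exists h, k. split; intros x; eauto.
Qed.

(** * Well-orders *)

Record well_order {W : Type} (lt : W -> W -> Prop) : Prop := {
  wo_wf : well_founded lt;
  wo_trans : forall x y z, lt x y -> lt y z -> lt x z;
  wo_total : forall x y, lt x y \/ x = y \/ lt y x
}.

Lemma wf_irrefl {W : Type} {lt : W -> W -> Prop} :
  well_founded lt -> forall x, ~ lt x x.
Proof.
  intros wf x. induction (wf x) as [x _ IH]. intros H. exact (IH x H H).
Qed.

Lemma is_cardinal_well_order {M : Type} {lt : M -> M -> Prop} :
  is_cardinal M lt -> well_order lt.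
Proof. intros [wf _ tr to _]. now constructor. Qed.

Definition seg {W : Type} (lt : W -> W -> Prop) (w : W) : Type := {v | lt v w}.

Lemma seg_mono {W : Type} {lt : W -> W -> Prop} : well_order lt ->
  forall v w, ~ lt w v -> card_le (seg lt v) (seg lt w).
Proof.
  intros wo v w H.
  assert (T : forall x, lt x v -> lt x w).
  { intros x Hx. destruct (wo_total _ wo v w) as [L|[<-|L]]; auto.
    - exact (wo_trans _ wo _ _ _ Hx L).
    - contradiction. }
  exists (fun x => exist _ (proj1_sig x) (T _ (proj2_sig x)) : seg lt w).
  intros x y E. apply sig_inj. exact (f_equal (@proj1_sig _ _) E).
Qed.

(* Greedy recursion: send w to a point of B not used before w. *)
Lemma well_order_compare {W : Type} {lt : W -> W -> Prop} (B : Type) :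
  well_order lt -> card_le W B \/ exists w, card_le B (seg lt w).
Proof.
  intros wo.
  destruct (classic (inhabited W)) as [[w0]|N].
  2:{ left. exists (fun w => False_rect B (N (inhabits w))).
      intros x. destruct (N (inhabits x)). }
  destruct (classic (inhabited B)) as [iB|N].
  2:{ right. exists w0. exists (fun b => False_rect _ (N (inhabits b))).
      intros x. destruct (N (inhabits x)). }
  set (F := fun w (rec : forall v, lt v w -> B) =>
              epsilon iB (fun b => forall v h, rec v h <> b)).
  set (f := Fix (wo_wf _ wo) (fun _ => B) F).
  assert (fE : forall w, f w = epsilon iB (fun b => forall v, lt v w -> f v <> b)).
  { intros w. unfold f at 1. rewrite Fix_eq; [reflexivity|].
    intros x u v E. unfold F. f_equal.
    apply functional_extensionality; intros b.
    replace v with u; [reflexivity|].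
    apply functional_extensionality_dep; intros y.
    apply functional_extensionality; intros h. apply E. }
  (* If the values taken before some [w] exhaust [B], choosing preimages embeds [B] below [w].
     Otherwise a fresh value always exists and [f] is injective. *)
  destruct (classic (exists w, forall b, exists v, lt v w /\ f v = b)) as [[w H]|N].
  - right. exists w. apply (card_le_of_rel (fun b (v : seg lt w) => f (proj1_sig v) = b)).
    + intros b. destruct (H b) as (v & L & E). now exists (exist _ v L).
    + congruence.
  - left. exists f.
    assert (H : forall v w, lt v w -> f v <> f w).
    { intros v w L. rewrite (fE w). revert v L. apply epsilon_spec.
      destruct (classic (exists b, forall v, lt v w -> f v <> b)) as [e|n]; [exact e|].
      destruct N. exists w. intros b. apply NNPP. intros n'. apply n.
      exists b. intros v L E. apply n'. now exists v. }
    intros x y E. destruct (wo_total _ wo x y) as [L|[L|L]]; auto.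
    + now destruct (H x y L).
    + now destruct (H y x L).
Qed.

(** * Hessenberg's theorem *)

Lemma nat_well_order : well_order lt.
Proof. constructor; [exact PeanoNat.Nat.lt_wf_0| |]; intros; lia. Qed.

Definition bounded_inj {X : Type} (n : nat) (f : X -> nat) : Prop :=
  (forall x y, f x = f y -> x = y) /\ forall x, f x < n.

Lemma not_infinite_bounded {X : Type} :
  ~ infinite X -> exists n (f : X -> nat), bounded_inj n f.
Proof.
  intros N. destruct (well_order_compare X nat_well_order) as [I|[n [f Hf]]].
  - contradiction.
  - exists n, (fun x => proj1_sig (f x)). split.
    + intros x y E. apply Hf, sig_inj, E.
    + intros x. exact (proj2_sig (f x)).
Qed.

(** Pigeonhole: the first n+1 terms of an injective sequence would have distinct labels below n. *)
Lemma bounded_not_infinite {X : Type} (n : nat) (f : X -> nat) :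
  bounded_inj n f -> ~ infinite X.
Proof.
  intros [Hf B] [e He].
  assert (L : length (map (fun i => f (e i)) (seq 0 (S n))) <= length (seq 0 n)).
  { apply NoDup_incl_length.
    - apply Injective_map_NoDup; [|apply seq_NoDup].
      intros x y E. auto.
    - intros y H. apply in_map_iff in H. destruct H as (i & <- & _).
      apply in_seq. specialize (B (e i)). lia. }
  rewrite length_map, !length_seq in L. lia.
Qed.

(** Hilbert's hotel along the sequence [e]: its terms move up by one and [None] goes to [e 0]. *)
Lemma infinite_option {X : Type} : infinite X -> card_le (option X) X.
Proof.
  intros [e He].
  apply (card_le_of_rel (fun o x => match o with
    | None => x = e 0
    | Some y => (exists n, y = e n /\ x = e (S n)) \/ ((forall n, y <> e n) /\ x = y)
    end)).
  - intros [y|]; [|eauto].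
    destruct (classic (exists n, y = e n)) as [[n E]|N].
    + exists (e (S n)). eauto.
    + exists y. right. split; [|reflexivity]. intros n E. apply N. eauto.
  - intros [y|] [y'|] x; try reflexivity.
    + intros [(n & -> & ->)|[N ->]] [(n' & -> & E)|[N' E]]; auto.
      * apply He in E. congruence.
      * now destruct (N' (S n)).
      * now destruct (N (S n')).
      * congruence.
    + intros [(n & -> & ->)|[N ->]] E.
      * apply He in E. discriminate.
      * now destruct (N 0).
    + intros E [(n & -> & ->)|[N ->]].
      * apply He in E. discriminate.
      * now destruct (N 0).
Qed.

Lemma le_seg_option {W : Type} (lt : W -> W -> Prop) (m : W) :
  card_le {x | x = m \/ lt x m} (option (seg lt m)).
Proof.
  apply (card_le_of_rel (fun x o => match o with
    | None => proj1_sig x = m | Some y => proj1_sig x = proj1_sig y end)).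
  - intros [x [E|L]].
    + now exists None.
    + now exists (Some (exist _ x L)).
  - intros x y [z|] E E'; apply sig_inj; congruence.
Qed.

Definition wo_max {W : Type} (lt : W -> W -> Prop) (a b : W) : W :=
  if excluded_middle_informative (lt a b) then b else a.

(* Goedel's ordering of pairs: first by maximum, then lexicographically. *)
Definition goedel_lt {W : Type} (lt : W -> W -> Prop) (p q : W * W) : Prop :=
  slexprod W (W * W) lt (slexprod W W lt lt)
    (wo_max lt (fst p) (snd p), p) (wo_max lt (fst q) (snd q), q).

Lemma slexprod_inv {A B : Type} {ltA : A -> A -> Prop} {ltB : B -> B -> Prop} {a b a' b'} :
  slexprod A B ltA ltB (a, b) (a', b') -> ltA a a' \/ (a = a' /\ ltB b b').
Proof. inversion 1; auto. Qed.

Lemma slexprod_well_order {A B : Type} {ltA : A -> A -> Prop} {ltB : B -> B -> Prop} :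
  well_order ltA -> well_order ltB -> well_order (slexprod A B ltA ltB).
Proof.
  intros woA woB. constructor.
  - apply wf_slexprod; [apply woA|apply woB].
  - intros [a b] [a' b'] [a'' b''] H H'.
    apply slexprod_inv in H. apply slexprod_inv in H'.
    destruct H as [H|[-> H]], H' as [H'|[-> H']].
    + apply left_slex. exact (wo_trans _ woA _ _ _ H H').
    + now apply left_slex.
    + now apply left_slex.
    + apply right_slex. exact (wo_trans _ woB _ _ _ H H').
  - intros [a b] [a' b'].
    destruct (wo_total _ woA a a') as [L|[<-|L]].
    + left. now apply left_slex.
    + destruct (wo_total _ woB b b') as [L|[<-|L]]; auto.
      * left. now apply right_slex.
      * right; right. now apply right_slex.
    + right; right. now apply left_slex.
Qed.

Lemma goedel_well_order {W : Type} {lt : W -> W -> Prop} :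
  well_order lt -> well_order (goedel_lt lt).
Proof.
  intros wo.
  assert (wo2 := slexprod_well_order wo (slexprod_well_order wo wo)).
  constructor; unfold goedel_lt.
  - exact (wf_inverse_image _ _ _ (fun p => (wo_max lt (fst p) (snd p), p)) (wo_wf _ wo2)).
  - intros p q r. apply (wo_trans _ wo2).
  - intros p q.
    destruct (wo_total _ wo2 (wo_max lt (fst p) (snd p), p) (wo_max lt (fst q) (snd q), q))
      as [L|[E|L]]; auto.
    right; left. congruence.
Qed.

(** Comparing maxima first confines the predecessors of [q] to the square of a closed segment. *)
Lemma goedel_lt_max {W : Type} {lt : W -> W -> Prop} : well_order lt ->
  forall a b q, let m := wo_max lt (fst q) (snd q) in
  goedel_lt lt (a, b) q -> (a = m \/ lt a m) /\ (b = m \/ lt b m).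
Proof.
  intros wo a b q m H. apply slexprod_inv in H. simpl in H. fold m in H.
  assert (Hm : wo_max lt a b = m \/ lt (wo_max lt a b) m) by tauto.
  assert (T : forall x y, x = y \/ lt x y -> y = m \/ lt y m -> x = m \/ lt x m).
  { intros x y [<-|L] [<-|L']; auto. right. exact (wo_trans _ wo _ _ _ L L'). }
  unfold wo_max in Hm.
  destruct (excluded_middle_informative (lt a b)) as [L|N]; split; auto.
  - apply (T a b); auto.
  - apply (T b a); auto. destruct (wo_total _ wo a b) as [?|[?|?]]; tauto || auto.
Qed.

(** If the square did not embed, comparability would place [V] inside the square of a closed
    segment, which is either finite or embeds in a proper segment. *)
Lemma square_of_initial {V : Type} {lt : V -> V -> Prop} :
  well_order lt -> infinite V ->
  (forall v, ~ card_le V (seg lt v)) ->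
  (forall v, infinite (seg lt v) -> card_le (seg lt v * seg lt v) (seg lt v)) ->
  card_le (V * V) V.
Proof.
  intros wo inf init IH.
  destruct (well_order_compare V (goedel_well_order wo)) as [?|[q Hq]]; [assumption|].
  exfalso. set (m := wo_max lt (fst q) (snd q)).
  set (X := {x | x = m \/ lt x m}).
  assert (H : card_le V (X * X)).
  { apply (card_le_trans Hq).
    apply (card_le_of_rel (fun (u : seg (goedel_lt lt) q) (v : X * X) =>
      proj1_sig u = (proj1_sig (fst v), proj1_sig (snd v)))).
    - intros [[a b] L]. destruct (goedel_lt_max wo a b q L) as [Ha Hb].
      now exists (exist _ a Ha, exist _ b Hb).
    - intros u u' v E E'. apply sig_inj. congruence. }
  destruct (classic (infinite (seg lt m))) as [I|N].
  - assert (HX : card_le X (seg lt m)).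
    { apply (card_le_trans (le_seg_option lt m)). now apply infinite_option. }
    apply (init m). apply (card_le_trans H).
    apply (card_le_trans (card_le_prod HX HX)). auto.
  - destruct (not_infinite_bounded N) as (n & f & Hf & Bf).
    destruct (le_seg_option lt m) as [e He].
    set (g := fun x : X => match e x with None => n | Some y => f y end).
    assert (Hg : bounded_inj (S n) g).
    { split; unfold g.
      - intros x y E. apply He.
        destruct (e x) as [a|], (e y) as [b|]; auto.
        + now rewrite (Hf _ _ E).
        + specialize (Bf a). lia.
        + specialize (Bf b). lia.
      - intros x. destruct (e x) as [a|]; [specialize (Bf a)|]; lia. }
    destruct Hg as [Hg Bg].
    (* Pairs of labels are coded as two-digit numbers in base [S n]. *)
    apply (bounded_not_infinite (S n * S n)
      (fun p : X * X => g (fst p) * S n + g (snd p))).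
    + split.
      * intros [a b] [a' b'] E; simpl in E.
        pose proof (Bg b). pose proof (Bg b').
        assert (g a = g a') by nia.
        f_equal; apply Hg; nia.
      * intros [a b]; simpl. pose proof (Bg a). pose proof (Bg b). nia.
    + exact (card_le_trans inf H).
Qed.

Lemma seg_well_order {W : Type} {lt : W -> W -> Prop} (w : W) : well_order lt ->
  well_order (fun u v : seg lt w => lt (proj1_sig u) (proj1_sig v)).
Proof.
  intros wo. constructor.
  - exact (wf_inverse_image _ _ _ (@proj1_sig _ _) (wo_wf _ wo)).
  - intros x y z. apply (wo_trans _ wo).
  - intros x y. destruct (wo_total _ wo (proj1_sig x) (proj1_sig y)) as [?|[?|?]]; auto.
    right; left. now apply sig_inj.
Qed.

(** Induction on [w]: a segment that embeds in a shorter one inherits the claim from it; any other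
    is an initial ordinal, covered by [square_of_initial]. *)
Lemma seg_square {W : Type} {lt : W -> W -> Prop} : well_order lt ->
  forall w, infinite (seg lt w) -> card_le (seg lt w * seg lt w) (seg lt w).
Proof.
  intros wo w. induction (wo_wf _ wo w) as [w _ IH]. intros inf.
  assert (S1 : forall v : seg lt w,
    card_le (seg lt (proj1_sig v))
      (seg (fun u v : seg lt w => lt (proj1_sig u) (proj1_sig v)) v)).
  { intros [v L].
    apply (card_le_of_rel (fun x y => proj1_sig x = proj1_sig (proj1_sig y))).
    - intros [x Lx].
      now exists (exist (fun u : seg lt w => lt (proj1_sig u) v)
               (exist _ x (wo_trans _ wo _ _ _ Lx L)) Lx).
    - intros x x' y E E'. apply sig_inj. congruence. }
  assert (S2 : forall v : seg lt w,
    card_le (seg (fun u v : seg lt w => lt (proj1_sig u) (proj1_sig v)) v)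
      (seg lt (proj1_sig v))).
  { intros v. apply (card_le_of_rel (fun y x => proj1_sig x = proj1_sig (proj1_sig y))).
    - intros [y L]. now exists (exist _ (proj1_sig y) L).
    - intros y y' x E E'. do 2 apply sig_inj. exact (eq_trans (eq_sym E) E'). }
  destruct (classic (exists v, lt v w /\ card_le (seg lt w) (seg lt v))) as [(v & L & H)|N].
  - apply (card_le_trans (card_le_prod H H)).
    apply (@card_le_trans _ (seg lt v)).
    + apply IH; [exact L|]. exact (card_le_trans inf H).
    + apply (seg_mono wo). intros L'.
      exact (wf_irrefl (wo_wf _ wo) _ (wo_trans _ wo _ _ _ L L')).
  - apply (square_of_initial (seg_well_order w wo) inf).
    + intros v H. apply N. exists (proj1_sig v). split; [exact (proj2_sig v)|].
      exact (card_le_trans H (S2 v)).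
    + intros v Hv. apply (card_le_trans (card_le_prod (S2 v) (S2 v))).
      apply (@card_le_trans _ (seg lt (proj1_sig v))); [|apply S1].
      apply IH; [exact (proj2_sig v)|]. exact (card_le_trans Hv (S2 v)).
Qed.

(** * Sets smaller than a cardinal *)

Lemma seg_small {M : Type} {lt : M -> M -> Prop} : is_cardinal M lt ->
  forall w, ~ card_le M (seg lt w).
Proof. intros card w. apply (card_initial _ _ card w). Qed.

Lemma cardinal_square {M : Type} {lt : M -> M -> Prop} :
  is_cardinal M lt -> infinite M -> card_le (M * M) M.
Proof.
  intros card inf. assert (wo := is_cardinal_well_order card).
  apply (square_of_initial wo inf); [exact (seg_small card)|exact (seg_square wo)].
Qed.

(** Smallness is carried as [~ card_le M A]; comparability turns this into a bound by a segment. *)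
Lemma small_le_seg {M A : Type} {lt : M -> M -> Prop} : well_order lt ->
  ~ card_le M A -> exists w, card_le A (seg lt w).
Proof. intros wo N. destruct (well_order_compare A wo); tauto. Qed.

Lemma small_common_seg {M A B : Type} {lt : M -> M -> Prop} : well_order lt ->
  ~ card_le M A -> ~ card_le M B ->
  exists w, card_le A (seg lt w) /\ card_le B (seg lt w).
Proof.
  intros wo HA HB.
  destruct (small_le_seg wo HA) as [a Ha], (small_le_seg wo HB) as [b Hb].
  destruct (classic (lt a b)) as [L|N].
  - exists b. split; [|exact Hb]. apply (card_le_trans Ha), (seg_mono wo).
    intros L'. exact (wf_irrefl (wo_wf _ wo) _ (wo_trans _ wo _ _ _ L L')).
  - exists a. split; [exact Ha|]. now apply (card_le_trans Hb), (seg_mono wo).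
Qed.

(** Both factors fit into one infinite segment, which absorbs its own square. *)
Lemma small_prod {M A B : Type} {lt : M -> M -> Prop} :
  is_cardinal M lt -> forall w0, infinite (seg lt w0) ->
  ~ card_le M A -> ~ card_le M B -> ~ card_le M (A * B).
Proof.
  intros card w0 inf HA HB H. assert (wo := is_cardinal_well_order card).
  destruct (small_common_seg wo HA HB) as (w1 & LA & LB).
  destruct (small_common_seg wo (seg_small card w0) (seg_small card w1))
    as (w & L0 & L1).
  apply (seg_small card w). apply (card_le_trans H).
  apply (card_le_trans (card_le_prod (card_le_trans LA L1) (card_le_trans LB L1))).
  apply (seg_square wo). exact (card_le_trans inf L0).
Qed.

(** [strong_limit] speaks only of subsets of [M], so [A] is first replaced by a segment bounding
    it. *)
Lemma strong_limit_powerset {M A : Type} {lt : M -> M -> Prop} :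
  is_cardinal M lt -> strong_limit M ->
  ~ card_le M A -> ~ card_le M (A -> bool).
Proof.
  intros card sl HA H. assert (wo := is_cardinal_well_order card).
  destruct (small_le_seg wo HA) as [w Hw].
  apply (sl (fun v => lt v w) (card_initial _ _ card w)).
  exact (card_le_trans H (card_le_powerset Hw)).
Qed.

(** * Regrouping coordinates into blocks *)

(* Regard [f : M -> R1] as an M-indexed family of blocks in [L -> R1] and
   apply [b] to every block. *)
Definition recode {M L R1 R2 : Type} (p : M -> M * L) (q : M * L -> M)
    (b : (L -> R1) -> (L -> R2)) (f : M -> R1) : M -> R2 :=
  fun m => b (fun l => f (q (fst (p m), l))) (snd (p m)).

Lemma recodeK {M L R1 R2 : Type} (p : M -> M * L) (q : M * L -> M)
    (b : (L -> R1) -> (L -> R2)) (b' : (L -> R2) -> (L -> R1)) :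
  (forall m, q (p m) = m) -> (forall x, p (q x) = x) ->
  (forall u, b' (b u) = u) ->
  forall f, recode p q b' (recode p q b f) = f.
Proof.
  intros qp pq bb f. apply functional_extensionality; intros m. unfold recode.
  replace (fun l => b (fun l0 => f (q (fst (p (q (fst (p m), l))), l0)))
                      (snd (p (q (fst (p m), l)))))
    with (b (fun l0 => f (q (fst (p m), l0)))).
  - now rewrite bb, <- surjective_pairing, qp.
  - apply functional_extensionality; intros l. now rewrite pq.
Qed.

(** A small condition on the output meets few blocks; freezing those blocks entirely in the input is
    still a small condition, by the hypothesis on [A * L]. *)
Lemma recode_continuous {M L R1 R2 : Type} (p : M -> M * L) (q : M * L -> M)
    (b : (L -> R1) -> (L -> R2)) :
  (forall m, q (p m) = m) -> (forall x, p (q x) = x) ->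
  (forall A, ~ card_le M A -> ~ card_le M (A * L)) ->
  box_continuous M M R1 M R2 (recode p q b).
Proof.
  intros qp pq small U HU f Uf.
  destruct (HU _ Uf) as (s & [_ Hs] & Es & Bs).
  set (used := fun d => exists l, s (q (fst (p d), l)) <> None).
  exists (fun d => if decide (used d) then Some (f d) else None).
  split; [split|split].
  - apply card_le_sig.
  - intros H. apply (small _ Hs). apply (card_le_trans H).
    apply (card_le_of_rel (fun d (e : {d | s d <> None} * L) =>
      p (proj1_sig d) = (fst (p (proj1_sig (fst e))), snd e))).
    + intros [d Hd].
      assert (used d) as [l Hl].
      { apply (proj1 (decideP _)). destruct (decide (used d)); congruence. }
      exists (exist (fun d => s d <> None) _ Hl, snd (p d)). simpl.
      rewrite pq. simpl. apply surjective_pairing.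
    + intros d d' e E E'. apply sig_inj.
      rewrite <- (qp (proj1_sig d)), <- (qp (proj1_sig d')). congruence.
  - intros d r. destruct (decide (used d)); congruence.
  - intros g Eg. apply Bs. intros d r E. rewrite <- (Es d r E).
    unfold recode. f_equal. apply functional_extensionality; intros l.
    apply Eg. replace (decide (used _)) with true; [reflexivity|].
    symmetry. apply decideP. exists (snd (p d)).
    rewrite pq. simpl. rewrite <- surjective_pairing, qp. congruence.
Qed.

Lemma homeomorphic_of_large_powerset {M : Type} {lt : M -> M -> Prop} :
  is_cardinal M lt -> forall w, infinite (seg lt w) ->
  card_le M (seg lt w -> bool) -> box_homeomorphic M M bool M M.
Proof.
  intros card w inf large. set (L := seg lt w) in *.
  assert (LM : card_le L M) by apply card_le_sig.
  assert (infM : infinite M) by exact (card_le_trans inf LM).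
  assert (sqL := seg_square (is_cardinal_well_order card) w inf). fold L in sqL.
  assert (blocks : card_eq (L -> bool) (L -> M)).
  { apply cantor_bernstein.
    - apply card_le_codomain. apply (@card_le_trans _ nat); [|exact infM].
      exists (fun b : bool => if b then 1 else 0). intros [] []; easy.
    (* |M^L| <= |(2^L)^L| <= |2^(L*L)| <= |2^L|. *)
    - apply (card_le_trans (card_le_codomain large)).
      apply (card_le_trans (card_le_curry _ _ _)).
      exact (card_le_powerset sqL). }
  assert (coords : card_eq M (M * L)).
  { apply cantor_bernstein.
    - destruct inf as [e _]. exists (fun m => (m, e 0)). congruence.
    - apply (card_le_trans (card_le_prod (card_le_refl M) LM)).
      exact (cardinal_square card infM). }
  destruct blocks as (b & b' & bb' & b'b), coords as (p & q & qp & pq).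
  assert (small : forall A, ~ card_le M A -> ~ card_le M (A * L)).
  { intros A HA. exact (small_prod card w inf HA (seg_small card w)). }
  exists (recode p q b), (recode p q b').
  repeat split; [now apply recodeK|now apply recodeK| |]; now apply recode_continuous.
Qed.

(** * Antichains of small partial functions into [bool] *)

Section Ancestors.
Context {W C : Type} (lt : W -> W -> Prop) (wf : well_founded lt) (c : W -> W -> C).

(* The end-homogeneity tree of the Erdos-Rado argument: t is an ancestor of s
   when t < s and every ancestor r of t satisfies c r t = c r s. *)
Definition ancestor : W -> W -> Prop :=
  Fix wf (fun _ => W -> Prop) (fun t rec s =>
    lt t s /\ forall r (h : lt r t), rec r h t -> c r t = c r s).

Lemma ancestorE t s :
  ancestor t s <-> lt t s /\ forall r, lt r t -> ancestor r t -> c r t = c r s.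
Proof.
  unfold ancestor at 1. rewrite Fix_eq; [reflexivity|].
  intros x u v E. replace v with u; [reflexivity|].
  apply functional_extensionality_dep; intros y.
  apply functional_extensionality; intros h. apply E.
Qed.
End Ancestors.

(* A point is determined by its well-ordered chain of ancestors; distinct
   ancestors of s have distinct colours towards s, so the chain is coded by a
   binary relation on colours. *)
Lemma triangle_free_bound {W C : Type} (lt : W -> W -> Prop) (c : W -> W -> C) :
  well_order lt ->
  (forall r s t, lt r s -> lt s t -> c r s = c r t -> c r t = c s t -> False) ->
  card_le W (C * C -> bool).
Proof.
  intros wo tri. pose (anc := ancestor lt (wo_wf _ wo) c).
  pose proof (ancestorE lt (wo_wf _ wo) c) as ancE. fold anc in ancE.
  assert (irr := wf_irrefl (wo_wf _ wo)).
  assert (lt_tr := wo_trans _ wo).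
  assert (anc_lt : forall t s, anc t s -> lt t s) by (intros t s H; now apply ancE in H).
  assert (anc_c : forall r t s, anc r t -> anc t s -> c r t = c r s).
  { intros r t s H H'. apply ancE in H'. apply H'; auto. }
  assert (anc_tr : forall r t s, anc r t -> anc t s -> anc r s).
  { intros r. induction (wo_wf _ wo r) as [r _ IH]. intros t s Hr Ht.
    apply ancE. split; [eauto|]. intros q L Hq.
    rewrite (anc_c q r t Hq Hr). apply anc_c; eauto. }
  assert (anc_chain : forall r t s, anc r s -> anc t s -> lt r t -> anc r t).
  { intros r. induction (wo_wf _ wo r) as [r _ IH]. intros t s Hr Ht L.
    apply ancE. split; [exact L|]. intros q Lq Hq.
    assert (Hqs : anc q s) by eauto.
    rewrite (anc_c q r s Hq Hr). symmetry. apply anc_c; [|exact Ht]. eauto. }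
  (* Equality would make r < t < s a monochromatic triangle, since r, an ancestor of t, has the same
     colour towards t and s. *)
  assert (col_lt : forall r t s, anc r s -> anc t s -> lt r t -> c r s <> c t s).
  { intros r t s Hr Ht L E. apply (tri r t s); auto.
    apply anc_c; eauto. }
  assert (col_inj : forall r t s, anc r s -> anc t s -> c r s = c t s -> r = t).
  { intros r t s Hr Ht E. destruct (wo_total _ wo r t) as [L|[L|L]]; auto.
    - now destruct (col_lt r t s).
    - now destruct (col_lt t r s). }
  (* The case r = t records which colours occur on the chain, the case r < t their order along
     it. *)
  set (code := fun s (p : C * C) => decide (exists r t, anc r s /\ anc t s /\
    c r s = fst p /\ c t s = snd p /\ (r = t \/ lt r t))).
  assert (codeE : forall s s', code s = code s' -> forall r t, anc r s -> anc t s ->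
    (r = t \/ lt r t) -> exists r' t', anc r' s' /\ anc t' s' /\
      c r' s' = c r s /\ c t' s' = c t s /\ (r' = t' \/ lt r' t')).
  { intros s s' E r t Hr Ht H.
    apply (proj1 (decideP _)). change (code s' (c r s, c t s) = true).
    rewrite <- E. apply decideP. now exists r, t. }
  (* Equal codes force equal chains. By induction, let r' be the ancestor of s' with the colour of
     r; the two chains agree below r and r'. *)
  assert (claim : forall s s', code s = code s' -> forall r, anc r s ->
    anc r s' /\ c r s' = c r s).
  { intros s s' E r. induction (wo_wf _ wo r) as [r _ IH]. intros Hr.
    destruct (codeE s s' E r r Hr Hr (or_introl eq_refl))
      as (r' & _ & Hr' & _ & Er' & _ & _).
    assert (F1 : forall q, lt q r -> anc q s ->
      lt q r' /\ anc q s' /\ c q s' = c q s).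
    { intros q L Hq. destruct (IH q L Hq) as [Hq' Eq].
      destruct (codeE s s' E q r Hq Hr (or_intror L))
        as (q' & r'' & A1 & A2 & A3 & A4 & A5).
      assert (r'' = r') by (apply (col_inj _ _ s'); congruence).
      assert (q' = q) by (apply (col_inj _ _ s'); congruence). subst r'' q'.
      destruct A5 as [->|A5]; [|auto].
      now destruct (col_lt r' r s Hq Hr L); congruence. }
    assert (F2 : forall q, lt q r' -> anc q s' ->
      lt q r /\ anc q s /\ c q s = c q s').
    { intros q L Hq.
      destruct (codeE s' s (eq_sym E) q r' Hq Hr' (or_intror L))
        as (q2 & r2 & A1 & A2 & A3 & A4 & A5).
      assert (r2 = r) by (apply (col_inj _ _ s); congruence). subst r2.
      destruct A5 as [->|A5].
      - destruct (col_lt q r' s' Hq Hr' L). congruence.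
      - destruct (IH q2 A5 A1) as [B1 B2].
        assert (q2 = q) by (apply (col_inj _ _ s'); congruence). subst q2. auto. }
    (* If r and r' differ, the smaller one is an ancestor of both s and s', and [F1] or [F2] puts it
       below itself. *)
    destruct (wo_total _ wo r r') as [L|[<-|L]]; [| now auto |]; exfalso.
    - assert (H : anc r s').
      { apply ancE. split; [eauto|]. intros q Lq Hq.
        destruct (F1 q Lq (anc_tr _ _ _ Hq Hr)) as (_ & _ & ->).
        now apply anc_c. }
      apply (irr r). now apply (F2 r L H).
    - assert (H : anc r' s).
      { apply ancE. split; [eauto|]. intros q Lq Hq.
        destruct (F2 q Lq (anc_tr _ _ _ Hq Hr')) as (_ & _ & ->).
        now apply anc_c. }
      apply (irr r'). now apply (F1 r' L H). }
  (* With equal chains and s < s', s would be an ancestor of s', hence of itself. *)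
  assert (no_lt : forall s s', code s = code s' -> ~ lt s s').
  { intros s s' E L.
    assert (H : anc s s').
    { apply ancE. split; [exact L|]. intros q _ Hq. symmetry.
      now apply (claim s s' E q Hq). }
    apply (irr s). apply anc_lt. now apply (claim s' s (eq_sym E) s H). }
  exists code. intros s s' E. destruct (wo_total _ wo s s') as [L|[L|L]]; auto.
  - now destruct (no_lt s s' E).
  - now destruct (no_lt s' s (eq_sym E)).
Qed.

Definition incompatible {X : Type} (s t : X -> option bool) : Prop :=
  exists x b, s x = Some b /\ t x = Some (negb b).

(* Colour a pair by the labels, in both domains, of a point of disagreement.
   A monochromatic triangle would make three booleans pairwise distinct. *)
Lemma antichain_bound {W X D : Type} (lt : W -> W -> Prop) (s : W -> X -> option bool) :
  well_order lt ->
  (forall w, card_le {x | s w x <> None} D) ->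
  (forall v w, v <> w -> incompatible (s v) (s w)) ->
  card_le W ((D * D) * (D * D) -> bool).
Proof.
  intros wo dom inc.
  destruct (choice_fun (fun w (e : {x | s w x <> None} -> D) =>
    forall x y, e x = e y -> x = y) dom) as [e He].
  assert (defd : forall w x b, s w x = Some b -> s w x <> None) by congruence.
  set (Q := fun v w (g : D * D) => exists x b (Hv : s v x = Some b)
    (Hw : s w x = Some (negb b)),
    e v (exist _ x (defd _ _ _ Hv)) = fst g /\ e w (exist _ x (defd _ _ _ Hw)) = snd g).
  assert (ex : forall v w, v <> w -> exists g, Q v w g).
  { intros v w N. destruct (inc v w N) as (x & b & Hv & Hw).
    exists (e v (exist _ x (defd _ _ _ Hv)), e w (exist _ x (defd _ _ _ Hw))).
    now exists x, b, Hv, Hw. }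
  assert (irr := wf_irrefl (wo_wf _ wo)).
  destruct (classic (inhabited (D * D))) as [[g0]|N].
  (* Without labels no two members can disagree, so [W] has at most one point and a constant map is
     injective. *)
  2:{ exists (fun _ _ => false). intros v w _. apply NNPP. intros H.
      destruct (ex v w H) as [g _]. apply N. now exists. }
  destruct (choice_fun (fun (p : W * W) g => fst p <> snd p -> Q (fst p) (snd p) g))
    as [c Hc].
  { intros [v w]. destruct (classic (v = w)) as [E|H].
    - now exists g0.
    - destruct (ex v w H) as [g Hg]. now exists g. }
  apply (triangle_free_bound lt (fun v w => c (v, w)) wo).
  intros r t u L L' E E'.
  assert (N1 : r <> t) by (intros ->; exact (irr _ L)).
  assert (N2 : t <> u) by (intros ->; exact (irr _ L')).
  assert (N3 : r <> u) by (intros ->; exact (irr _ (wo_trans _ wo _ _ _ L L'))).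
  destruct (Hc (r, t) N1) as (x & b & A1 & A2 & A3 & A4).
  destruct (Hc (r, u) N3) as (y & b' & B1 & B2 & B3 & B4).
  destruct (Hc (t, u) N2) as (z & b'' & C1 & C2 & C3 & C4).
  simpl in *. rewrite E in A3, A4. rewrite <- E' in C3, C4.
  (* Equal labels in the domain of [s r] identify x with y, and in the domain of [s u] y with z. *)
  assert (H := He r _ _ (eq_trans A3 (eq_sym B3))). injection H as ->.
  assert (H := He u _ _ (eq_trans B4 (eq_sym C4))). injection H as ->.
  destruct b, b', b''; simpl in *; congruence.
Qed.

(** * Cellularity of the two spaces *)

Lemma cofinal_map {M K : Type} {lt : M -> M -> Prop} :
  cf_is lt K -> exists c : K -> M, forall x, exists i, ~ lt (c i) x.
Proof.
  intros [(X & cof & f & g & gf & _) _].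
  exists (fun i => proj1_sig (g i)). intros x.
  destruct (cof x) as (y & Xy & N). exists (f (exist _ y Xy)). now rewrite gf.
Qed.

Lemma not_homeomorphic_of_strong_limit {K M : Type} {lt : M -> M -> Prop} :
  infinite K -> is_cardinal M lt -> cf_is lt K -> card_lt K M ->
  strong_limit M -> ~ box_homeomorphic M M bool M M.
Proof.
  intros infK card cf [[e He] KM] sl (h & k & _ & hk & ch & _).
  assert (wo := is_cardinal_well_order card).
  destruct (small_le_seg wo KM) as [w0 Hw0].
  assert (inf := card_le_trans infK Hw0 : infinite (seg lt w0)).
  (* These sets are pairwise disjoint; [s g] below is a small condition whose box [h] maps into
     [U g]. *)
  set (U := fun (g : K -> M) F => forall i, F (e i) = g i).
  destruct (choice_fun (fun (g : K -> M) (s : M -> option bool) =>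
    small_dom M s /\ forall f, ext s f -> U g (h f))) as [s Hs].
  { intros g.
    destruct (choice_fun (fun d m => forall i, e i = d -> m = g i)) as [F HF].
    { intros d. destruct (classic (exists i, e i = d)) as [[i <-]|N].
      - exists (g i). intros j E. now rewrite (He _ _ E).
      - exists d. intros i E. destruct N. now exists i. }
    destruct (ch (U g)) with (f := k F) as (s & Ss & _ & Bs).
    - intros G HG. exists (fun d => if decide (exists i, e i = d) then Some (G d) else None).
      split; [split|split].
      + apply card_le_sig.
      + intros H. apply KM. apply (card_le_trans H).
        apply (card_le_of_rel (fun d i => e i = proj1_sig d)).
        * intros [d Hd]. apply (proj1 (decideP _)). simpl.
          destruct (decide (exists i, e i = d)); congruence.
        * intros d d' i E E'. apply sig_inj. congruence.
      + intros d r. destruct (decide _); congruence.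
      + intros G' E i. rewrite <- HG. apply E.
        replace (decide _) with true; [reflexivity|].
        symmetry. apply decideP. now exists i.
    - rewrite hk. intros i. now apply HF.
    - now exists s. }
  assert (inc : forall g g', g <> g' -> incompatible (s g) (s g')).
  { intros g g' N. apply NNPP. intros NI. apply N.
    (* If the conditions are compatible, f extends both, so [h f] lies in both [U g] and [U g']. *)
    set (f := fun d => match s g d with
      | Some b => b
      | None => match s g' d with Some b => b | None => false end end).
    apply functional_extensionality; intros i.
    transitivity (h f (e i)); [symmetry|]; apply Hs; intros d b E; unfold f.
    - now rewrite E.
    - rewrite E. destruct (s g d) as [b'|] eqn:E'; [|reflexivity].
      apply NNPP. intros N'. apply NI. exists d, b'. split; [exact E'|].
      rewrite E. now destruct b, b'. }
  (* An injection of [M] would index an antichain with domains bounded by one segment, so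
     [antichain_bound] would embed [M] in the power set of a small set. *)
  assert (few : forall w, ~ card_le M {g | card_le {d | s g d <> None} (seg lt w)}).
  { intros w [a Ha].
    assert (sq : ~ card_le M (seg lt w * seg lt w)).
    { apply (small_prod card w0 inf); apply (seg_small card). }
    apply (@strong_limit_powerset M _ lt card sl (small_prod card w0 inf sq sq)).
    apply (antichain_bound lt (fun m => s (proj1_sig (a m))) wo).
    - intros m. exact (proj2_sig (a m)).
    - intros m m' N. apply inc. intros E. apply N, Ha, sig_inj, E. }
  destruct (cofinal_map cf) as [c Hc].
  (* Koenig's diagonal: f differs at i from each of the few g attached to c i. *)
  destruct (choice_fun (fun i x => forall g,
    card_le {d | s g d <> None} (seg lt (c i)) -> g i <> x)) as [f Hf].
  { intros i. apply NNPP. intros N. apply (few (c i)).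
    apply (card_le_of_rel (fun x g => proj1_sig g i = x)); [|congruence].
    intros x. apply NNPP. intros N'. apply N. exists x. intros g Hg E.
    apply N'. now exists (exist _ g Hg). }
  (* By cofinality the domain of [s f] fits below some [c i], so f is among the functions it was
     made to avoid at i. *)
  destruct (Hs f) as [[_ Sf] _]. destruct (small_le_seg wo Sf) as [w Hw].
  destruct (Hc w) as [i Hi].
  exact (Hf i f (card_le_trans Hw (seg_mono wo _ _ Hi)) eq_refl).
Qed.

Theorem mainTheorem7 (K : Type) (ltK : K -> K -> Prop)
  (M : Type) (ltM : M -> M -> Prop) :
  regular_infinite K ltK ->
  is_cardinal M ltM ->
  cf_is ltM K ->
  card_lt K M ->
  (box_homeomorphic M M bool M M <-> ~ strong_limit M).
Proof.
  intros (_ & infK & _) card cf KM. split.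
  - intros hom sl. exact (not_homeomorphic_of_strong_limit infK card cf KM sl hom).
  - intros nsl. assert (wo := is_cardinal_well_order card).
    assert (ex : exists A : M -> Prop, ~ card_le M {x | A x} /\
      ~ card_lt ({x | A x} -> bool) M).
    { apply NNPP. intros N. apply nsl. intros A [_ HA].
      apply NNPP. intros H. apply N. now exists A. }
    destruct ex as (A & HA & large).
    (* Bounding [K] together with [A] makes the segment infinite. *)
    destruct (small_common_seg wo HA (proj2 KM)) as (w & Aw & Kw).
    apply (homeomorphic_of_large_powerset card w (card_le_trans infK Kw)).
    apply (@card_le_trans _ ({x | A x} -> bool)); [|exact (card_le_powerset Aw)].
    (* If [M] did not embed in the power set, comparability would embed the power set in a segment
       of [M], making it strictly smaller. *)
    apply NNPP. intros H. apply large. split; [|exact H].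
    destruct (small_le_seg wo H) as [v Hv].
    exact (card_le_trans Hv (card_le_sig _)).
Qed.
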